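(* Let $r(s)$ be any regular curve in $\mathbb{R}^3$ parametrized by arc length. There exists no developable surface possessing $r(s)$ as an asymptotic curve except the plane; that is, any developable surface possessing $r(s)$ as an asymptotic curve is a part of a plane.
   Context: A curve on a surface is asymptotic if its velocity is always a direction of zero normal curvature; for a curve $r(s)$ on a surface with normal $n(s)$ along $r$ this is expressed as $n'(s)\cdot r'(s)=0$ for all $s$. A ruled surface $P(s,t)=\alpha(s)+(t-t_0)\,d(s)$, with base curve $\alpha$ and ruling direction $d$, is developable if and only if $\det\big(\alpha'(s),d(s),d'(s)\big)=0$ for all $s$.
   Formalization: The developable surface is taken to be a ruled surface, regular along the curve, every ruling of which meets the curve (as when the curve is the base curve); without this the claim fails, e.g. a ruling of a circular cylinder is asymptotic but the cylinder is not planar. *)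

(* Defs.v *)
From mathcomp Require Import all_boot all_order all_algebra.
From mathcomp Require Import all_classical all_reals all_analysis.

Set Implicit Arguments.
Unset Strict Implicit.
Unset Printing Implicit Defensive.

Import Order.TTheory GRing.Theory Num.Theory.
Import numFieldNormedType.Exports.

Local Open Scope ring_scope.
Local Open Scope classical_set_scope.

Section Vectors.
Context {R : realType}.
Implicit Types u v w : 'rV[R]_3.

Definition dot u v : R := \sum_(i < 3) u 0 i * v 0 i.

(* The library norm on ['rV[R]_3] is the sup norm, hence a separate Euclidean
   norm.  The topology, and so the derivatives, are the same for both. *)
Definition enorm u : R := Num.sqrt (dot u u).

Definition det3 u v w : R :=
  \det (\matrix_(i < 3, j < 3) (nth 0 [:: u; v; w] i) 0 j).

(* The k-th coordinate of the cross product is its dot product with the k-th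
   vector of the standard basis, i.e. a mixed product. *)
Definition cross u v : 'rV[R]_3 := \row_(k < 3) det3 (delta_mx 0 k) u v.

End Vectors.

Section Curves.
Context {R : realType}.
Implicit Types (I K : set R) (r : R -> 'rV[R]_3).

Definition open_interval I := open I /\ is_interval I.

Definition derivable_on {V : normedModType R} I (f : R -> V) :=
  forall s, I s -> derivable f s 1.

Definition arclength_curve K r :=
  derivable_on K r /\ forall s, K s -> enorm (derive1 r s) = 1.

End Curves.

Section Surfaces.
Context {R : realType}.
Implicit Types (I K : set R) (P : R -> R -> 'rV[R]_3) (r : R -> 'rV[R]_3).

Definition surface_normal P (u t : R) : 'rV[R]_3 :=
  cross (derive1 (fun x => P x t) u) (derive1 (P u) t).

(* A curve s |-> P (sigma s) (tau s) given by its coordinates in the parameter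
   domain; the surface must have a nonzero normal along it. *)
Definition curve_on P K (sigma tau : R -> R) r :=
  [/\ derivable_on K sigma,
      derivable_on K tau,
      forall s, K s -> r s = P (sigma s) (tau s)
    & forall s, K s -> surface_normal P (sigma s) (tau s) != 0].

(* The normal is not normalized: as n is orthogonal to r', the condition
   n' . r' = 0 is unchanged when n is multiplied by a nonvanishing
   differentiable function. *)
Definition asymptotic_curve_on P K (sigma tau : R -> R) r :=
  curve_on P K sigma tau r /\
  forall s, K s ->
    dot (derive1 (fun x => surface_normal P (sigma x) (tau x)) s) (derive1 r s) = 0.

Definition ruled_surface (alpha d : R -> 'rV[R]_3) (t0 : R) (s t : R) :
  'rV[R]_3 := alpha s + (t - t0) *: d s.

Definition developable I (alpha d : R -> 'rV[R]_3) :=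
  [/\ derivable_on I alpha, derivable_on I (derive1 alpha),
      derivable_on I d, derivable_on I (derive1 d)
    & forall s, I s -> det3 (derive1 alpha s) (d s) (derive1 d s) = 0].

(* An asymptotic curve is carried by the ruled surface over [I] when moreover
   it meets every ruling.  A straight ruling of a cylinder is asymptotic
   without meeting the other rulings, so this cannot be dropped.  The case of
   a base curve is [alpha = r], [sigma = id], [tau] constant equal to [t0]. *)
Definition possesses_as_asymptotic I (alpha d : R -> 'rV[R]_3) (t0 : R) K r :=
  exists sigma tau : R -> R,
    sigma @` K = I /\
    asymptotic_curve_on (ruled_surface alpha d t0) K sigma tau r.

Definition part_of_plane (S : set 'rV[R]_3) :=
  exists q n : 'rV[R]_3, n != 0 /\ forall x, S x -> dot n (x - q) = 0.

End Surfaces.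

(* Main.v *)
Require Import Defs.
From mathcomp Require Import all_boot all_order all_algebra.
From mathcomp Require Import all_classical all_reals all_analysis.
From mathcomp Require Import ring lra.
Import numFieldNormedType.Exports.
Import Order.TTheory GRing.Theory Num.Theory.
Local Open Scope ring_scope.
Local Open Scope classical_set_scope.

(* Along the curve let [p] be the partial derivative of the surface in the
   parameter indexing the rulings, [d] the ruling direction and [N = p x d].
   Developability gives [N . d' = 0], hence [N' . d = 0].  The velocity is
   [sigma' p + tau' d], so that the asymptotic condition reads
   [sigma' (N' . p) = 0]; and [N' . p] also vanishes where [sigma' = 0], being
   then [- tau' (N . d')].  So [N'] is orthogonal to [p] and to [d], that is
   parallel to [N], and [N] has a constant direction [n].  As [n] is
   orthogonal to [r'] and to all rulings, and [r] meets all rulings, the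
   surface lies in the plane through a point of [r] with normal [n]. *)

(** * Coordinate formulas and vector identities in dimension three *)

Section Algebra.
Set Implicit Arguments.
Unset Strict Implicit.
Context {R : realType}.
Implicit Types u v w : 'rV[R]_3.

Lemma forall_ord3 (P : 'I_3 -> Prop) : P 0 -> P 1 -> P 2 -> forall i, P i.
Proof.
move=> P0 P1 P2 [[|[|[|//]]] hi].
- by rewrite (_ : Ordinal hi = 0)//; exact: val_inj.
- by rewrite (_ : Ordinal hi = 1)//; exact: val_inj.
- by rewrite (_ : Ordinal hi = 2)//; exact: val_inj.
Qed.

Lemma dotE u v : dot u v = u 0 0 * v 0 0 + u 0 1 * v 0 1 + u 0 2 * v 0 2.
Proof.
rewrite /dot !big_ord_recl big_ord0 addr0 addrA.
by congr (_ + u 0 _ * v 0 _ + u 0 _ * v 0 _); exact: val_inj.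
Qed.

Lemma det3E u v w : det3 u v w =
  u 0 0 * (v 0 1 * w 0 2 - v 0 2 * w 0 1)
  - u 0 1 * (v 0 0 * w 0 2 - v 0 2 * w 0 0)
  + u 0 2 * (v 0 0 * w 0 1 - v 0 1 * w 0 0).
Proof.
rewrite /det3 (expand_det_row _ 0) /cofactor !big_ord_recl big_ord0.
rewrite !(expand_det_row _ (0 : 'I_2)) /cofactor !big_ord_recl !big_ord0.
rewrite !det_mx11 !mxE /=.
(* Indices coming from the minors are ordinals carrying different proofs. Reading coordinates
   through functions on [nat] identifies them, so that [ring] applies. *)
have natE (x : 'rV[R]_3) : {f : nat -> R | forall i, x 0 i = f i}.
  by exists (fun i => x 0 (inord i)) => i; rewrite inord_val.
have [[[f fE] [g gE]] [h hE]] := (natE u, natE v, natE w).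
rewrite !fE !gE !hE /bump /= !(add0n, addn0) expr0 expr1 sqrrN expr1n.
by ring.
Qed.

Lemma crossE u v :
  ((cross u v 0 0 = u 0 1 * v 0 2 - u 0 2 * v 0 1) *
   (cross u v 0 1 = u 0 2 * v 0 0 - u 0 0 * v 0 2) *
   (cross u v 0 2 = u 0 0 * v 0 1 - u 0 1 * v 0 0))%type.
Proof. by split; [split|]; rewrite !mxE det3E !mxE /=; ring. Qed.

Lemma dot_cross u v w : dot u (cross v w) = det3 u v w.
Proof. by rewrite dotE !crossE det3E; ring. Qed.

Lemma dotC u v : dot u v = dot v u.
Proof. by rewrite !dotE; ring. Qed.

Lemma dotDr u v w : dot u (v + w) = dot u v + dot u w.
Proof. by rewrite !dotE !mxE; ring. Qed.

Lemma dotZr u (a : R) v : dot u (a *: v) = a * dot u v.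
Proof. by rewrite !dotE !mxE; ring. Qed.

Lemma dotNr u v : dot u (- v) = - dot u v.
Proof. by rewrite !dotE !mxE; ring. Qed.

Lemma dot_gt0 u : u != 0 -> 0 < dot u u.
Proof.
move=> u0; have : 0 <= dot u u by rewrite dotE; nra.
rewrite le_eqVlt => /orP[/eqP/esym|//]; rewrite dotE => h.
suff e : u = 0 by rewrite e eqxx in u0.
by apply/rowP; apply: forall_ord3; rewrite mxE; nra.
Qed.

Lemma cross_crossE u v w : cross u (cross v w) = dot u w *: v - dot u v *: w.
Proof.
by apply/rowP; apply: forall_ord3; rewrite !crossE !dotE !mxE; ring.
Qed.

(* [e] stands for [d'], [q] for the second derivative of the surface in the
   parameter indexing the rulings, and [x], [y] for [sigma'], [tau']. *)
Lemma normal_derivative_parallel (a p q v e : 'rV[R]_3) (w x y : R) :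
  p = a + w *: e -> det3 a v e = 0 ->
  let n' := cross (x *: q + y *: e) v + cross p (x *: e) in
  dot n' (x *: p + y *: v) = 0 -> cross n' (cross p v) = 0.
Proof.
move=> pE ave n' nr.
(* [p] and [a] differ by a multiple of [e], which does not affect the determinant. *)
have pve : det3 p v e = 0.
  by rewrite -ave pE !det3E !mxE; ring.
(* By expansion, [dot n' v] is [- x * det3 p v e]. The zero on the right is rewritten into this form
   so that [ring] can conclude; likewise below with [- y]. *)
have nv : dot n' v = 0.
  rewrite /n' dotC dotDr !dot_cross -(mulr0 (- x)) -pve.
  by rewrite !det3E !mxE; ring.
have np : dot n' p = - x * det3 p v q.
  rewrite /n' dotC dotDr !dot_cross -[RHS]addr0 -(mulr0 (- y)) -pve.
  by rewrite !det3E !mxE; ring.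
have np0 : dot n' p = 0.
  move: nr; rewrite dotDr !dotZr nv mulr0 addr0 => /eqP.
  by rewrite mulf_eq0 => /orP[/eqP x0|/eqP//]; rewrite np x0 oppr0 mul0r.
by rewrite cross_crossE nv np0 !scale0r subr0.
Qed.

End Algebra.

(** * Derivatives of vector-valued functions, and functions constant on an interval *)

Section Calculus.
Set Implicit Arguments.
Unset Strict Implicit.
Context {R : realType}.
Implicit Types (K : set R) (s : R).

Lemma is_derive_row n (f : R -> 'rV[R]_n) s (df : 'rV[R]_n) :
  is_derive s 1 f df <-> forall i, is_derive s 1 (fun x => f x 0 i) (df 0 i).
Proof.
split=> [[fs <-] i|fs].
  apply: DeriveDef; first by have /derivable_mxP := fs; exact.
  by rewrite (derive_mx fs) mxE.
have fs' : derivable f s 1.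
  by apply/derivable_mxP => i j; rewrite ord1; have [] := fs j.
by apply: DeriveDef => //; rewrite (derive_mx fs'); apply/rowP => j;
  rewrite mxE; have [] := fs j.
Qed.

Lemma is_derive1_derive1 {V : normedModType R} (f : R -> V) s :
  derivable f s 1 -> is_derive s 1 f (derive1 f s).
Proof. by move=> fs; apply: DeriveDef => //; rewrite derive1E. Qed.

Lemma derive1_val {V : normedModType R} (f : R -> V) s (df : V) :
  is_derive s 1 f df -> derive1 f s = df.
Proof. by case=> _ <-; rewrite derive1E. Qed.

Lemma is_derive_rowZ n (a : R -> R) (f : R -> 'rV[R]_n) s (da : R) df :
  is_derive s 1 a da -> is_derive s 1 f df ->
  is_derive s 1 (fun x => a x *: f x) (da *: f s + a s *: df).
Proof.
move=> as1 /is_derive_row fs; apply/is_derive_row => i.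
have -> : (fun x => (a x *: f x) 0 i) = a * (fun x => f x 0 i).
  by apply/funext => x; rewrite mxE.
have /= fsi := fs i.
by apply: is_derive_eq; rewrite !mxE /GRing.scale /=; ring.
Qed.

Lemma is_derive_row_comp n (f : R -> 'rV[R]_n) (g : R -> R) s
    (df : 'rV[R]_n) (dg : R) :
  is_derive (g s) 1 f df -> is_derive s 1 g dg ->
  is_derive s 1 (fun x => f (g x)) (dg *: df).
Proof.
move=> /is_derive_row fs gs; apply/is_derive_row => i.
by rewrite mxE mulrC; exact: is_derive1_comp (fs i) gs.
Qed.

Lemma is_derive_dot (u v : R -> 'rV[R]_3) s (du dv : 'rV[R]_3) :
  is_derive s 1 u du -> is_derive s 1 v dv ->
  is_derive s 1 (fun x => dot (u x) (v x)) (dot du (v s) + dot (u s) dv).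
Proof.
move=> /is_derive_row us /is_derive_row vs.
have -> : (fun x => dot (u x) (v x)) =
    (fun x => u x 0 0) * (fun x => v x 0 0)
    + (fun x => u x 0 1) * (fun x => v x 0 1)
    + (fun x => u x 0 2) * (fun x => v x 0 2).
  by apply/funext => x; rewrite dotE.
have [u0 u1 u2] := And3 (us 0) (us 1) (us 2).
have [v0 v1 v2] := And3 (vs 0) (vs 1) (vs 2).
by apply: is_derive_eq; rewrite !dotE /GRing.scale /=; ring.
Qed.

Lemma is_derive_cross (u v : R -> 'rV[R]_3) s (du dv : 'rV[R]_3) :
  is_derive s 1 u du -> is_derive s 1 v dv ->
  is_derive s 1 (fun x => cross (u x) (v x)) (cross du (v s) + cross (u s) dv).
Proof.
move=> /is_derive_row us /is_derive_row vs; apply/is_derive_row.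
have [u0 u1 u2] := And3 (us 0) (us 1) (us 2).
have [v0 v1 v2] := And3 (vs 0) (vs 1) (vs 2).
(* All three coordinates of a cross product have this shape. *)
have minor (a b c e : R -> R) (da db dc de : R) :
    is_derive s 1 a da -> is_derive s 1 b db ->
    is_derive s 1 c dc -> is_derive s 1 e de ->
    is_derive s 1 (fun x => a x * b x - c x * e x)
      ((da * b s - dc * e s) + (a s * db - c s * de)).
  move=> a' b' c' e'.
  by apply: (is_derive_eq (is_deriveB (is_deriveM a' b') (is_deriveM c' e')));
    rewrite /GRing.scale /=; ring.
by apply: forall_ord3; under eq_fun do rewrite crossE;
  rewrite mxE !crossE; exact: minor.
Qed.

Lemma near_open_interval K s : open_interval K -> K s -> \forall x \near s, K x.
Proof. by move=> [Ko _] Ks; exact: open_nbhs_nbhs. Qed.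

(** This is the mean value theorem on [[s, t]], which lies in [K] because [K] is an interval. *)
Lemma derive0_cst K (f : R -> R) : open_interval K ->
  (forall s, K s -> is_derive s 1 f 0) -> forall s t, K s -> K t -> f s = f t.
Proof.
move=> [_ Ki] f0.
suff le_cst s t : s <= t -> K s -> K t -> f s = f t.
  by move=> s t Ks Kt; case: (leP s t) => [|/ltW] st; [|apply/esym]; exact: le_cst.
move=> st Ks Kt.
have inK x : x \in `[s, t]%R -> K x.
  by rewrite in_itv /= => xst; exact: (Ki s t).
have [| |c _] := @MVT_segment _ f (fun=> 0) s t st.
- by move=> x /subset_itv_oo_cc /inK /f0.
- by apply: derivable_within_continuous => x /inK /f0 [].
- by rewrite mul0r => /eqP; rewrite subr_eq0 => /eqP.
Qed.

(* The unit normal is only determined up to sign, so it is the projection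
   [N N^T / |N|^2] onto the line of [N] that is differentiated. *)
Lemma direction_cst K (N dN : R -> 'rV[R]_3) : open_interval K ->
  (forall s, K s -> is_derive s 1 N (dN s)) ->
  (forall s, K s -> N s != 0) ->
  (forall s, K s -> cross (dN s) (N s) = 0) ->
  forall s t v, K s -> K t -> dot (N s) v = 0 -> dot (N t) v = 0.
Proof.
move=> hK dN' N0 par s t v Ks Kt.
pose Q x := dot (N x) (N x).
have Q0 x : K x -> Q x != 0 by move=> /N0 /dot_gt0 /lt0r_neq0.
have cst i j : N s 0 i * N s 0 j / Q s = N t 0 i * N t 0 j / Q t.
  apply: (@derive0_cst K (fun x => N x 0 i * N x 0 j / Q x)) => // x Kx.
  have QV := is_deriveV (Q0 _ Kx) (is_derive_dot (dN' _ Kx) (dN' _ Kx)).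
  have /is_derive_row Nx := dN' _ Kx.
  have [Ni Nj] := (Nx i, Nx j).
  have Nij : is_derive x 1 (fun y => N y 0 i * N y 0 j)
    (N x 0 i * dN x 0 j + N x 0 j * dN x 0 i) := is_deriveM Ni Nj.
  apply: (is_derive_eq (is_deriveM Nij QV)).
  (* The coordinates of [dN x] times [N x], as a cross product, are the differences of the two
     sides; their vanishing makes the matrix of products symmetric. *)
  have swap k l : dN x 0 k * N x 0 l = N x 0 k * dN x 0 l.
    have [[c0 c1] c2] := crossE (dN x) (N x).
    rewrite par // !mxE in c0 c1 c2.
    by move: k l; apply: forall_ord3; apply: forall_ord3; lra.
  (* Symmetry moves the derivative from the indices [i], [j] to [k]. Summing over [k] then gives
     [E], which is the vanishing of the numerator in the quotient rule. *)
  have swap_sq k :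
      N x 0 k * N x 0 k * (N x 0 i * dN x 0 j + N x 0 j * dN x 0 i) =
      N x 0 i * N x 0 j * (N x 0 k * dN x 0 k + N x 0 k * dN x 0 k).
    transitivity (N x 0 k * (N x 0 i * (dN x 0 j * N x 0 k)
      + N x 0 j * (dN x 0 i * N x 0 k))); first by ring.
    by rewrite (swap j k) (swap i k); ring.
  have E : Q x * (N x 0 i * dN x 0 j + N x 0 j * dN x 0 i) =
      N x 0 i * N x 0 j * (dot (N x) (dN x) + dot (N x) (dN x)).
    by rewrite {1}/Q !dotE !mulrDl !swap_sq; ring.
  have q0 := Q0 _ Kx.
  rewrite /GRing.scale /= dotC.
  (* Two factors [Q x] clear the denominators of the derivative of the quotient. *)
  apply: (mulfI q0); apply: (mulfI q0); rewrite !mulr0.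
  rewrite -[RHS](subrr (Q x * (N x 0 i * dN x 0 j + N x 0 j * dN x 0 i))).
  by rewrite [X in _ = _ - X]E; field.
(* Applied to [v], the constant projection gives [N_i (N . v) / Q] in coordinate [i]. This is zero
   at [s], hence at [t], where some [N_i] is nonzero. *)
move=> sv; suff tv i : N t 0 i * dot (N t) v = 0.
  have [k Nk] : exists k, N t 0 k != 0 by apply/rV0Pn; exact: N0.
  by have /eqP := tv k; rewrite mulf_eq0 (negPf Nk) => /eqP.
have : N t 0 i * dot (N t) v / Q t = N s 0 i * dot (N s) v / Q s.
  rewrite !dotE !mulrDr !mulrDl.
  have c k : N t 0 i * (N t 0 k * v 0 k) / Q t
      = N s 0 i * (N s 0 k * v 0 k) / Q s.
    by rewrite !mulrA mulrAC -cst mulrAC.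
  by rewrite !c.
rewrite sv mulr0 mul0r => /eqP; rewrite mulf_eq0 invr_eq0 (negPf (Q0 _ Kt)) orbF.
by move/eqP.
Qed.

End Calculus.

(** * Normals of ruled surfaces and curves on them *)

Section RuledSurfaces.
Set Implicit Arguments.
Unset Strict Implicit.
Context {R : realType}.
Implicit Types (I : set R) (alpha d : R -> 'rV[R]_3).

Lemma surface_normal_ruled alpha d (t0 u t : R) :
  derivable alpha u 1 -> derivable d u 1 ->
  surface_normal (ruled_surface alpha d t0) u t =
  cross (derive1 alpha u + (t - t0) *: derive1 d u) (d u).
Proof.
move=> au du; rewrite /surface_normal; congr cross; apply: derive1_val.
  exact: is_deriveD (is_derive1_derive1 au) (is_deriveZ _ (is_derive1_derive1 du)).
have t' : is_derive t 1 (fun x => x - t0) 1 := is_derive_shift _ _ _.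
have := is_deriveD (is_derive_cst (alpha u) t 1)
  (is_derive_rowZ t' (is_derive_cst (d u) t 1)).
by rewrite scaler0 scale1r add0r addr0.
Qed.

(** This serves twice: with [alpha] and [d] it gives the velocity of the curve; with their
    derivatives it differentiates [p] along the curve, since [p] is again a ruled parametrization,
    with base [alpha'] and direction [d']. *)
Lemma is_derive_ruled_curve alpha d (t0 : R) (sigma tau : R -> R) (s : R) :
  derivable alpha (sigma s) 1 -> derivable d (sigma s) 1 ->
  derivable sigma s 1 -> derivable tau s 1 ->
  is_derive s 1 (fun x => ruled_surface alpha d t0 (sigma x) (tau x))
    (derive1 sigma s *: (derive1 alpha (sigma s)
       + (tau s - t0) *: derive1 d (sigma s))
     + derive1 tau s *: d (sigma s)).
Proof.
move=> /is_derive1_derive1 a /is_derive1_derive1 e.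
move=> /is_derive1_derive1 ss /is_derive1_derive1 ts.
have w : is_derive s 1 (fun x => tau x - t0) (derive1 tau s).
  by rewrite -[derive1 tau s]subr0; exact: is_deriveB.
apply: (is_derive_eq (is_deriveD (is_derive_row_comp a ss)
  (is_derive_rowZ w (is_derive_row_comp e ss)))).
by apply/rowP => i; rewrite !mxE; ring.
Qed.

End RuledSurfaces.

Theorem corollary4p3 (R : realType) (K : set R) (r : R -> 'rV[R]_3)
    (hK : open_interval K) (hr : arclength_curve K r)
    (I : set R) (hI : open_interval I)
    (alpha d : R -> 'rV[R]_3) (t0 : R)
    (hdev : developable I alpha d)
    (hasy : possesses_as_asymptotic I alpha d t0 K r) :
  part_of_plane [set ruled_surface alpha d t0 s t | s in I & t in [set: R]].
Proof.
case: hasy => sigma [tau [sigmaK [[sigma' tau' rE N0] asym]]].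
case: hdev => alpha' alpha'' d' d'' dev.
have IK s : K s -> I (sigma s) by move=> Ks; rewrite -sigmaK; exists s.
pose p u t := derive1 alpha u + (t - t0) *: derive1 d u.
pose N s := cross (p (sigma s) (tau s)) (d (sigma s)).
have NE s : K s -> surface_normal (ruled_surface alpha d t0) (sigma s) (tau s) = N s.
  by move=> /IK Is; rewrite surface_normal_ruled//; [exact: alpha'|exact: d'].
pose q u t := derive1 (derive1 alpha) u + (t - t0) *: derive1 (derive1 d) u.
pose dN s := cross (derive1 sigma s *: q (sigma s) (tau s)
    + derive1 tau s *: derive1 d (sigma s)) (d (sigma s))
  + cross (p (sigma s) (tau s)) (derive1 sigma s *: derive1 d (sigma s)).
have N' s : K s -> is_derive s 1 N (dN s).
  move=> Ks; apply: is_derive_cross.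
    exact: is_derive_ruled_curve (alpha'' _ (IK _ Ks)) (d'' _ (IK _ Ks))
      (sigma' _ Ks) (tau' _ Ks).
  exact: is_derive_row_comp (is_derive1_derive1 (d' _ (IK _ Ks)))
    (is_derive1_derive1 (sigma' _ Ks)).
pose dr s := derive1 sigma s *: p (sigma s) (tau s) + derive1 tau s *: d (sigma s).
have r' s : K s -> is_derive s 1 r (dr s).
  move=> Ks.
  have := is_derive_ruled_curve t0 (alpha' _ (IK _ Ks)) (d' _ (IK _ Ks))
    (sigma' _ Ks) (tau' _ Ks).
  (* [rE] is an equality on [K] only, but [K] is open, so it holds near [s] and the derivatives
     agree. The same argument is used below with [NE]. *)
  apply: near_eq_is_derive.
  by apply: filterS (near_open_interval hK Ks) => x Kx; rewrite rE.
have par s : K s -> cross (dN s) (N s) = 0.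
  move=> Ks; apply: (normal_derivative_parallel (erefl _) (dev _ (IK _ Ks))).
  rewrite -[RHS](asym _ Ks) (derive1_val (r' _ Ks)); congr dot; apply/esym/derive1_val.
  apply: near_eq_is_derive (N' _ Ks).
  by apply: filterS (near_open_interval hK Ks) => x Kx; rewrite NE.
have Nn0 s : K s -> N s != 0 by move=> Ks; rewrite -NE// N0.
(* If [K] is empty, so is its image [I], and the surface has no points: any plane will do. *)
have [[s0 Ks0]|K0] := pselect (exists s, K s); last first.
  exists 0, (const_mx 1); split.
    by apply/eqP => /rowP /(_ 0); rewrite !mxE => /eqP; rewrite oner_eq0.
  by move=> x [u + _]; rewrite -sigmaK => -[s Ks _]; case: K0; exists s.
have cst := direction_cst hK N' Nn0 par.
(* [d] and [p] are orthogonal to their cross product [N s], and [cst] carries this over to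
   [N s0]. *)
have nd s : K s -> dot (N s0) (d (sigma s)) = 0.
  by move=> Ks; apply: (cst s) => //; rewrite dotC dot_cross !det3E; ring.
have np s : K s -> dot (N s0) (p (sigma s) (tau s)) = 0.
  by move=> Ks; apply: (cst s) => //; rewrite dotC dot_cross !det3E; ring.
have nr s : K s -> dot (N s0) (r s) = dot (N s0) (r s0).
  move=> Ks; apply: (@derive0_cst _ K (fun x => dot (N s0) (r x))) => // x Kx.
  apply: (is_derive_eq (is_derive_dot (is_derive_cst (N s0) x 1) (r' _ Kx))).
  by rewrite dotC /dr !dotDr !dotZr nd// np// !mulr0 dotE !mxE; ring.
exists (r s0), (N s0); split; first exact: Nn0.
move=> _ [u + [t _ <-]]; rewrite -sigmaK => -[s Ks <-].
(* The ruling is parametrized from its point [r s] on the curve instead of from [alpha]. *)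
have -> : ruled_surface alpha d t0 (sigma s) t = r s + (t - tau s) *: d (sigma s).
  by rewrite rE// /ruled_surface -addrA -scalerDl; congr (_ + _ *: _); ring.
by rewrite !dotDr dotNr dotZr nd// nr//; ring.
Qed.
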